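(* Let $\mathcal{A}$ be a Banach algebra such that $\mathrm{rad}(\mathcal{A})=\mathrm{rann}(\mathcal{A})$ and $\mathcal{A}/\mathrm{rad}(\mathcal{A})$ is commutative, and suppose $\mathcal{A}$ has a right identity. Let $d$ be a derivation of $\mathcal{A}$. Then the following are equivalent: (i) $d$ is an inner derivation; (ii) there exists $b_0\in\mathcal{A}$ such that for every $k\in\mathbb{N}$ the map $a\mapsto d(a)+b_0a$ is $k$-commuting; (iii) there exist $b_0\in\mathcal{A}$ and $k\in\mathbb{N}$ such that the map $a\mapsto d(a)+b_0a$ is $k$-commuting; (iv) there exist $b_0\in\mathcal{A}$ and $k\in\mathbb{N}$ such that the map $a\mapsto d(a)+b_0a$ is $k$-centralizing.
   Context: $\mathrm{rad}(\mathcal{A})$ is the Jacobson radical and $\mathrm{rann}(\mathcal{A})=\{c\in\mathcal{A}: ac=0\ \forall a\in\mathcal{A}\}$. A derivation is a linear map $d$ with $d(ab)=d(a)b+ad(b)$; it is inner if there is $b\in\mathcal{A}$ with $d(a)=ab-ba$ for all $a$. $Z(\mathcal{A})$ is the center, $[a,b]=ab-ba$. A map $T$ is $k$-centralizing (resp. $k$-commuting) if $[T(a),a^k]\in Z(\mathcal{A})$ (resp. $=0$) for all $a\in\mathcal{A}$. *)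

(* Defs.v *)
(* A (possibly non-unital) complex Banach algebra is
   a complete normed space A over C = R[i] (R : realType) together with an
   explicit multiplication that is bilinear, associative and submultiplicative. *)
From HB Require Import structures.
From mathcomp Require Import all_boot all_algebra.
From mathcomp Require Import all_classical all_reals all_analysis.
From mathcomp Require Export complex.
Import numFieldNormedType.Exports.
Set Implicit Arguments. Unset Strict Implicit. Unset Printing Implicit Defensive.
Import GRing.Theory Num.Theory.
Local Open Scope ring_scope.
Local Open Scope classical_set_scope.

Section BanachAlgebra.
Variables (R : realType) (A : completeNormedModType R[i]) (mul : A -> A -> A).

Definition banach_algebra_mul : Prop :=
  [/\ (forall x y z, mul x (mul y z) = mul (mul x y) z),
      (forall (c : R[i]) x y z, mul (c *: x + y) z = c *: mul x z + mul y z),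
      (forall (c : R[i]) x y z, mul z (c *: x + y) = c *: mul z x + mul z y) &
      (forall x y, `|mul x y| <= `|x| * `|y|)].

Definition left_ideal (L : set A) : Prop :=
  [/\ L 0,
      (forall x y, L x -> L y -> L (x + y)),
      (forall (c : R[i]) x, L x -> L (c *: x)) &
      (forall a x, L x -> L (mul a x))].

Definition modular_left_ideal (L : set A) : Prop :=
  left_ideal L /\ exists u, forall a, L (a - mul a u).

Definition maximal_modular_left_ideal (L : set A) : Prop :=
  [/\ modular_left_ideal L, L != setT &
      forall L' : set A, left_ideal L' -> L' != setT -> L `<=` L' -> L' = L].

(* Jacobson radical: intersection of all maximal modular left ideals
   (equal to A if there are none). *)
Definition jacobson_rad : set A :=
  [set a | forall L, maximal_modular_left_ideal L -> L a].

Definition rann : set A := [set c | forall a, mul a c = 0].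

Definition center : set A := [set c | forall a, mul c a = mul a c].

Definition commutator (a b : A) : A := mul a b - mul b a.

Definition quotient_by_rad_commutative : Prop :=
  forall a b, jacobson_rad (commutator a b).

Definition has_right_identity : Prop := exists e, forall a, mul a e = a.

Definition derivation (d : A -> A) : Prop :=
  [/\ (forall (c : R[i]) x y, d (c *: x + y) = c *: d x + d y) &
      (forall a b, d (mul a b) = mul (d a) b + mul a (d b))].

Definition inner_derivation (d : A -> A) : Prop :=
  exists b, forall a, d a = commutator a b.

(* a^k for k >= 1 (apow a k = a^k when 1 <= k; apow a 0 = a is junk) *)
Definition apow (a : A) (k : nat) : A := iter k.-1 (fun x => mul x a) a.

Definition k_commuting (k : nat) (T : A -> A) : Prop :=
  forall a, commutator (T a) (apow a k) = 0.

Definition k_centralizing (k : nat) (T : A -> A) : Prop :=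
  forall a, center (commutator (T a) (apow a k)).

End BanachAlgebra.

(* Main.v *)
(* With a right identity [e], [A] is the direct sum of the commutative unital
   algebra [eA], which is semisimple since [rad A = rann A], and of [rann A],
   which [d] preserves. Hence [x |-> e d(x)] is a derivation of [eA], and it
   vanishes by Johnson's theorem, so that [d] maps [A] into [rann A]. Condition
   (iv) then says that [G a = d a + b0 a - a b0] satisfies [G a * a^k = 0];
   as [G e = 0], replacing [a] by [a + t e] with [t] large, which is invertible
   in [eA], gives [G = 0].

   Johnson's theorem (derivations of a commutative semisimple Banach algebra
   are zero) is obtained as follows. Let [S] be the separating space of [D].
   If [S] is nonzero, a gliding hump yields [b] with [bS] nonzero such that
   every [a] either kills [bS] or maps it onto a dense subspace of [bS];
   semisimplicity then gives an idempotent [f] in [S] such that [fV] is a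
   field, [fV = C f] by Gelfand-Mazur, and [fD = 0] contradicts [f] in [S].
   So [S = 0], [D] is bounded by the closed graph theorem, and the
   Kleinecke-Shirokov identity [ad_a^n(D^n) = n! (D a)^n] makes [D a]
   quasinilpotent, hence zero. *)
Require Import Defs.
From HB Require Import structures.
From mathcomp Require Import all_boot all_order all_algebra.
From mathcomp Require Import all_classical all_reals all_analysis.
From mathcomp Require Import complex.
From mathcomp Require Import ring lra.
Import numFieldNormedType.Exports.
Set Implicit Arguments. Unset Strict Implicit. Unset Printing Implicit Defensive.
Import Order.TTheory GRing.Theory Num.Theory.
Local Open Scope ring_scope.
Local Open Scope classical_set_scope.
Local Open Scope complex_scope.

(* Completeness is only required for sequences whose increments decay
   geometrically, and comes with the rate of convergence. *)
Definition complete_algebra_norm (R : realType) (V : comAlgType R[i])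
    (nrm : V -> R) : Prop :=
  [/\ (forall x y, nrm (x + y) <= nrm x + nrm y),
      (forall (c : R[i]) x, nrm (c *: x) = Normc.normc c * nrm x),
      (forall x, nrm x = 0 -> x = 0),
      (forall x y, nrm (x * y) <= nrm x * nrm y) &
      (forall (u : nat -> V) (r : nat -> R),
         (forall n, 0 <= r n) -> (forall n, r n.+1 <= r n / 2) ->
         (forall n, nrm (u n.+1 - u n) <= r n / 2) ->
         exists l, forall n, nrm (l - u n) <= r n)].

(** * Norm calculus in complete normed commutative algebras *)

Section NormedAlgebra.
Variables (R : realType) (V : comAlgType R[i]) (nrm : V -> R).
Variable hn : complete_algebra_norm nrm.

Lemma nrmD x y : nrm (x + y) <= nrm x + nrm y. Proof. by case: hn. Qed.

Lemma nrmZ (c : R[i]) x : nrm (c *: x) = Normc.normc c * nrm x.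
Proof. by case: hn. Qed.

Lemma nrm0_eq0 x : nrm x = 0 -> x = 0. Proof. by case: hn => _ _ h _ _; exact: h. Qed.

Lemma nrmM x y : nrm (x * y) <= nrm x * nrm y. Proof. by case: hn. Qed.

Lemma nrm_complete (u : nat -> V) (r : nat -> R) :
  (forall n, 0 <= r n) -> (forall n, r n.+1 <= r n / 2) ->
  (forall n, nrm (u n.+1 - u n) <= r n / 2) ->
  exists l, forall n, nrm (l - u n) <= r n.
Proof. by case: hn => _ _ _ _; exact. Qed.

Lemma normc_real (r : R) : Normc.normc r%:C = `|r|.
Proof. by rewrite /= expr0n /= addr0 sqrtr_sqr. Qed.

Lemma nrmZr (r : R) x : nrm (r%:C *: x) = `|r| * nrm x.
Proof. by rewrite nrmZ normc_real. Qed.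

Lemma nrm0 : nrm 0 = 0.
Proof. by rewrite -(scale0r (0 : V)) nrmZ Normc.normc0 mul0r. Qed.

Lemma nrmN x : nrm (- x) = nrm x.
Proof.
have -> : - x = (-1 : R)%:C *: x by rewrite rmorphN rmorph1 scaleN1r.
by rewrite nrmZr normrN1 mul1r.
Qed.

Lemma nrm_ge0 x : 0 <= nrm x.
Proof. by have := nrmD x (- x); rewrite subrr nrm0 nrmN; lra. Qed.

Lemma nrmB x y : nrm (x - y) <= nrm x + nrm y.
Proof. by have := nrmD x (- y); rewrite nrmN. Qed.

Lemma nrmBC x y : nrm (x - y) = nrm (y - x).
Proof. by rewrite -nrmN opprB. Qed.

Lemma nrm_tri z x y : nrm (x - y) <= nrm (x - z) + nrm (z - y).
Proof. by have := nrmD (x - z) (z - y); rewrite addrA subrK. Qed.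

Lemma nrm_gt0 x : x <> 0 -> 0 < nrm x.
Proof.
by move=> x0; rewrite lt_neqAle nrm_ge0 eq_sym andbT; apply/eqP => /nrm0_eq0.
Qed.

Lemma nrmM_le x y a b : nrm x <= a -> nrm y <= b -> nrm (x * y) <= a * b.
Proof.
move=> xa yb; apply: (le_trans (nrmM _ _)).
by apply: ler_pM => //; exact: nrm_ge0.
Qed.

Lemma nrmX_le (x : V) n : nrm (x ^+ n.+1) <= nrm x ^+ n.+1.
Proof.
elim: n => [|n IHn]; first by rewrite !expr1.
rewrite exprS [leRHS]exprS; exact: nrmM_le.
Qed.

Lemma nrm_small_eq0 x : (forall e, 0 < e -> nrm x <= e) -> x = 0.
Proof.
move=> xe; apply: nrm0_eq0; apply/eqP; rewrite eq_le nrm_ge0 andbT.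
by apply/ler_addgt0Pl => e e0; rewrite addr0 xe.
Qed.

End NormedAlgebra.

(** Since n + 2 <= 2 (n + 1), halving preserves the bound [r n * (n + 1) <= r 0], and the
    Archimedean property concludes. *)
Lemma halving_small (R : realType) (r : nat -> R) :
  (forall n, 0 <= r n) -> (forall n, r n.+1 <= r n / 2) ->
  forall e, 0 < e -> exists n, r n < e.
Proof.
move=> r0 rS e e0.
have rn n : r n * n.+1%:R <= r 0%N.
  elim: n => [|n IHn]; first by rewrite mulr1.
  apply: le_trans IHn; have := rS n; have := r0 n.
  have : (0 : R) <= n%:R by [].
  rewrite -(natr1 n.+1) -(natr1 n); set a := n%:R; move=> a0 rn0 rnS.
  have : r n.+1 * (a + 1 + 1) <= r n / 2 * (a + 1 + 1) by apply: ler_wpM2r => //; lra.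
  have : 0 <= r n * a by apply: mulr_ge0.
  lra.
exists (Num.bound (r 0%N / e)); set m := Num.bound _.
have m1 : r 0%N / e < m.+1%:R.
  by apply: lt_le_trans (archi_boundP _) _; rewrite ?ler_nat // divr_ge0 // ltW.
rewrite -(ltr_pM2r (ltr0Sn R m)); apply: le_lt_trans (rn m) _.
by rewrite mulrC -ltr_pdivrMr.
Qed.

Lemma half_pow_halving (R : realType) (c : R) : 0 <= c ->
  (forall n, 0 <= c * 2^-1 ^+ n) /\
  (forall n, c * 2^-1 ^+ n.+1 <= c * 2^-1 ^+ n / 2).
Proof.
move=> c0; split=> n; last by rewrite exprS mulrCA mulrC.
by rewrite mulr_ge0 // exprn_ge0 // invr_ge0.
Qed.

(** * Neumann series and invertibility near the unit *)

Section Inverses.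
Variables (R : realType) (V : comAlgType R[i]) (nrm : V -> R).
Variable hn : complete_algebra_norm nrm.

Lemma nrm_halving_eq0 (x : V) (c : R) (r : nat -> R) :
  (forall n, 0 <= r n) -> (forall n, r n.+1 <= r n / 2) -> 0 <= c ->
  (forall n, nrm x <= c * r n) -> x = 0.
Proof.
move=> r0 rS c0 xr; apply: (nrm_small_eq0 hn) => e e0.
have [|n rn] := @halving_small R r r0 rS (e / (c + 1)).
  by rewrite divr_gt0 // ltr_wpDl.
apply: (le_trans (xr n)).
move: rn; rewrite ltr_pdivlMr ?ltr_wpDl // mulrDr mulr1 mulrC => rn.
by have := r0 n; lra.
Qed.

Lemma neumann (x : V) : nrm x <= 1 / 2 -> exists y, (1 - x) * y = 1.
Proof.
move=> x1.
(* The unit may have norm other than 1, hence the factor [nrm 1]; the factor 2 makes [r n / 2] bound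
   the [n]-th term. *)
have [r0 rS] := @half_pow_halving R (2 * nrm 1) (mulr_ge0 (ler0n R 2) (nrm_ge0 hn 1)).
set r := fun n => 2 * nrm 1 * 2^-1 ^+ n in r0 rS.
have xn n : nrm (x ^+ n) <= r n / 2.
  elim: n => [|n IHn]; first by rewrite /r expr0; lra.
  rewrite exprS; apply: (le_trans (nrmM_le hn x1 IHn)).
  by rewrite /r exprS; lra.
have [n|l hl] := nrm_complete hn r0 rS (u := fun n => \sum_(i < n) x ^+ i).
  by rewrite big_ord_recr /= addrC addrK.
exists l; apply/eqP; rewrite -subr_eq0; apply/eqP.
apply: (@nrm_halving_eq0 _ (nrm (1 - x) + 1) r) => // [|n].
  by rewrite addr_ge0 ?(nrm_ge0 hn).
have -> : (1 - x) * l - 1 = (1 - x) * (l - \sum_(i < n) x ^+ i) - x ^+ n.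
  by rewrite mulrBr -[(1 - x) * \sum_(i < n) _]opprK -mulNr opprB -subrX1; ring.
apply: (le_trans (nrmB hn _ _)).
have := nrmM_le hn (lexx (nrm (1 - x))) (hl n).
by have := xn n; have := r0 n; rewrite -/(r n); lra.
Qed.

Lemma near_one_inv (x : V) : nrm (1 - x) <= 1 / 2 -> exists y, x * y = 1.
Proof. by move=> /neumann; rewrite opprB addrC subrK. Qed.

End Inverses.

(** * Separating spaces and the closed graph theorem *)

Section LinearMap.
Variables (K : pzRingType) (U W : lmodType K) (T : U -> W).
Hypothesis linT : forall (c : K) x y, T (c *: x + y) = c *: T x + T y.

Lemma lin_map0 : T 0 = 0.
Proof. by have := linT (-1) 0 0; rewrite scaler0 addr0 scaleN1r addNr. Qed.

Lemma lin_mapD x y : T (x + y) = T x + T y.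
Proof. by have := linT 1 x y; rewrite !scale1r. Qed.

Lemma lin_mapZ (c : K) x : T (c *: x) = c *: T x.
Proof. by have := linT c x 0; rewrite !addr0 lin_map0 addr0. Qed.

Lemma lin_mapB x y : T (x - y) = T x - T y.
Proof. by rewrite lin_mapD -scaleN1r lin_mapZ scaleN1r. Qed.

End LinearMap.

Section ClosedGraph.
Variables (R : realType) (V : comAlgType R[i]) (nrm : V -> R).
Variable hn : complete_algebra_norm nrm.
Variable T : V -> V.
Hypothesis linT : forall (c : R[i]) x y, T (c *: x + y) = c *: T x + T y.

(** The limits of [T x] along null sequences: [0] is the only one exactly when the graph of [T] is
    closed. *)
Definition separating (s : V) :=
  forall e, 0 < e -> exists x, nrm x < e /\ nrm (T x - s) < e.

Lemma separating0 : separating 0.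
Proof. by move=> e e0; exists 0; rewrite (lin_map0 linT) subrr (nrm0 hn). Qed.

Lemma separatingD s t : separating s -> separating t -> separating (s + t).
Proof.
move=> hs ht e e0; have e20 : 0 < e / 2 by rewrite divr_gt0.
have [x [x1 x2]] := hs _ e20; have [y [y1 y2]] := ht _ e20.
exists (x + y); split; first by have := nrmD hn x y; lra.
have -> : T (x + y) - (s + t) = (T x - s) + (T y - t) by rewrite (lin_mapD linT); ring.
by have := nrmD hn (T x - s) (T y - t); lra.
Qed.

Lemma separatingZ (c : R[i]) s : separating s -> separating (c *: s).
Proof.
move=> hs e e0; set k := Normc.normc c.
have k0 : 0 <= k by rewrite /k; case: (c) => a b; apply: sqrtr_ge0.
have [|x [x1 x2]] := hs (e / (k + 1)); first by rewrite divr_gt0 // ltr_wpDl.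
move: x1 x2; rewrite !ltr_pdivlMr ?ltr_wpDl // => x1 x2.
exists (c *: x); rewrite (lin_mapZ linT) -scalerBr !(nrmZ hn) -/k.
by have := nrm_ge0 hn x; have := nrm_ge0 hn (T x - s); split; nra.
Qed.

Lemma separatingB s t : separating s -> separating t -> separating (s - t).
Proof.
move=> hs ht; apply: separatingD => //; rewrite -scaleN1r.
exact: separatingZ.
Qed.

Let near_sep c x := exists s, separating s /\ nrm (T x - s) <= c.

(** A Baire category argument: the sets [near_sep n] exhaust the space, so one of them is dense in
    some ball. *)
Let near_sep_dense_ball : exists x0 r c, 0 < r /\
  forall y, nrm (y - x0) < r ->
  forall e, 0 < e -> exists g, near_sep c g /\ nrm (y - g) < e.
Proof.
apply: contrapT => H.
have {}H (s : nat * V * R) : exists y : V * R, 0 < s.2 ->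
    [/\ nrm (y.1 - s.1.2) < s.2 / 2, 0 < y.2 &
        forall g, near_sep s.1.1%:R g -> y.2 <= nrm (y.1 - g)].
  case: s => -[n x] r /=; apply: contrapT => H'; apply: H.
  exists x, (r / 2), n%:R; split.
    by apply: contrapT => r0; apply: H'; exists (0, 0) => r1; lra.
  move=> y yx e e0; apply: contrapT => Hg; apply: H'; exists (y, e) => _ /=.
  split=> // g gn; rewrite leNgt; apply/negP => yg; apply: Hg; by exists g.
have [f hf] := choice H.
(* Centre and radius of nested balls. The new radius is at most half the gap between the new centre
   and [near_sep n], so the limit [l] avoids every [near_sep n]. *)
pose st := fix st n : V * R := if n is m.+1 then
  let y := f (m, (st m).1, (st m).2) in (y.1, Num.min (y.2 / 2) ((st m).2 / 2))
  else (0, 1).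
have st0 n : 0 < (st n).2.
  elim: n => [|n IHn] /=; first exact: ltr01.
  have [_ h _] := hf (n, (st n).1, (st n).2) IHn.
  by rewrite lt_min !divr_gt0.
have [n|n|n|l hl] := nrm_complete hn (u := fun n => (st n).1) (r := fun n => (st n).2).
- exact: ltW.
- by rewrite /= ge_min lexx orbT.
- by have [/ltW] := hf (n, (st n).1, (st n).2) (st0 n).
have n0 := nrm_ge0 hn (T l).
set n := Num.bound (nrm (T l)).
have [_ h] := hf (n, (st n).1, (st n).2) (st0 n).
move=> /(_ l) h1.
have := hl n.+1; rewrite (nrmBC hn) /= => h2.
have : near_sep n%:R l.
  exists 0; split; first exact: separating0.
  by rewrite subr0 ltW // archi_boundP.
move=> /h1 h3; have := le_trans h3 h2; rewrite le_min; lra.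
Qed.

(** Approximate [x0 + k x] and [x0] inside the dense ball, subtract, and divide by [k]. *)
Let near_sep_half : exists C, 0 <= C /\ forall x, exists g s,
  [/\ separating s, nrm (T g - s) <= C * nrm x & nrm (x - g) <= nrm x / 2].
Proof.
have [x0 [r [c [r0 H]]]] := near_sep_dense_ball.
have [g0 [[s0 [_ c0]] _]] : exists g, near_sep c g /\ nrm (x0 - g) < 1.
  by apply: H => //; rewrite subrr (nrm0 hn).
have {s0}c0 : 0 <= c by apply: le_trans (nrm_ge0 hn _) c0.
exists (2 * c * 2 / r); split; first by rewrite !mulr_ge0 // invr_ge0 ltW.
move=> x; have [->|/eqP x1] := eqVneq x 0.
  exists 0, 0; split; first exact: separating0.
    by rewrite (lin_map0 linT) subrr (nrm0 hn) mulr0.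
  by rewrite subr0 (nrm0 hn) mul0r.
(* [k] brings [x] to norm [r / 2], inside the ball; two errors of [r / 8] then make up half of that
   norm. *)
have {}x1 := nrm_gt0 hn x1; set k := r / 2 / nrm x.
have k0 : 0 < k by rewrite !divr_gt0.
have kV : k^-1 = nrm x * 2 / r by rewrite /k; field; rewrite !gt_eqF.
have [||g1 [[s1 [ss1 gs1]] xg1]] := H (x0 + k%:C *: x) _ (r / 8).
- by rewrite addrC addKr (nrmZr hn) gtr0_norm // /k divfK ?gt_eqF //; lra.
- by rewrite divr_gt0.
have [||g2 [[s2 [ss2 gs2]] xg2]] := H x0 _ (r / 8).
- by rewrite subrr (nrm0 hn).
- by rewrite divr_gt0.
exists ((k^-1)%:C *: (g1 - g2)), ((k^-1)%:C *: (s1 - s2)); split.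
- exact/separatingZ/separatingB.
- rewrite (lin_mapZ linT) -scalerBr (nrmZr hn) gtr0_norm ?invr_gt0 // (lin_mapB linT).
  have -> : T g1 - T g2 - (s1 - s2) = (T g1 - s1) - (T g2 - s2) by ring.
  have le2 := nrmB hn (T g1 - s1) (T g2 - s2).
  have -> : 2 * c * 2 / r * nrm x = k^-1 * (2 * c) by rewrite kV; ring.
  by apply: ler_wpM2l; [rewrite invr_ge0 ltW | lra].
have {1}-> : x = (k^-1)%:C *: (k%:C *: x).
  by rewrite scalerA -rmorphM /= mulVf ?gt_eqF // scale1r.
rewrite -scalerBr (nrmZr hn) gtr0_norm ?invr_gt0 //.
have -> : k%:C *: x - (g1 - g2) = (x0 + k%:C *: x - g1) - (x0 - g2) by ring.
have le2 := nrmB hn (x0 + k%:C *: x - g1) (x0 - g2).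
have -> : nrm x / 2 = k^-1 * (r / 4) by rewrite kV; field; rewrite gt_eqF.
by apply: ler_wpM2l; [rewrite invr_ge0 ltW | lra].
Qed.

(** Modulo its separating space [T] is bounded, which contains the closed graph theorem. The
    approximation is iterated on the remainders [z n], whose norms are halved at each stage, and the
    corrected images are summed. *)
Lemma dist_separating_bounded :
  exists K, 0 <= K /\ forall x, exists s, separating s /\ nrm (T x - s) <= K * nrm x.
Proof.
have [C [C0 H]] := near_sep_half.
have [g /choice [sg hg]] := choice H.
exists (2 * C); split; first by rewrite mulr_ge0.
move=> x; pose z := fix z n := if n is m.+1 then z m - g (z m) else x.
pose y n := \sum_(i < n) (T (g (z i)) - sg (z i)).
pose r n := nrm x * 2^-1 ^+ n.
have [r0 rS] : (forall n, 0 <= r n) /\ (forall n, r n.+1 <= r n / 2).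
  exact: half_pow_halving (nrm_ge0 hn x).
have zr n : nrm (z n) <= r n.
  elim: n => [|n IHn] /=; first by rewrite /r expr0 mulr1.
  have [_ _ h] := hg (z n); apply: (le_trans h).
  by rewrite /r exprS mulrCA mulrC; rewrite ler_wpM2l //; rewrite /r in IHn; lra.
have [n|n|n|l hl] := nrm_complete hn (u := y) (r := fun n => 2 * C * r n).
- by do 2! apply: mulr_ge0 => //.
- have : C * r n.+1 <= C * (r n / 2) by apply: ler_wpM2l.
  lra.
- have -> : y n.+1 - y n = T (g (z n)) - sg (z n) by rewrite /y big_ord_recr /=; ring.
  have [_ h _] := hg (z n); apply: (le_trans h).
  have : C * nrm (z n) <= C * r n by apply: ler_wpM2l.
  lra.
exists (T x - l); split; last first.
  rewrite subKr; have := hl 0%N; rewrite /y big_ord0 subr0 /r expr0 mulr1.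
  by [].
(* This difference is the sum of the corrections [sg (z i)] for i < n. *)
have Sy n : separating (T x - y n - T (z n)).
  elim: n => [|n IHn]; first by rewrite /y big_ord0 subr0 subrr; exact: separating0.
  have [h _ _] := hg (z n).
  rewrite /y big_ord_recr /= (lin_mapB linT) -/(y n).
  have -> : T x - (y n + (T (g (z n)) - sg (z n))) - (T (z n) - T (g (z n))) =
    (T x - y n - T (z n)) + sg (z n) by ring.
  exact: separatingD.
(* Here [z n + w] is small, and its image is close to [T x - l]. *)
move=> e e0; have [|n rn] := halving_small r0 rS (e := e / 2 / (2 * C + 1)).
  by rewrite !divr_gt0 // ltr_wpDl // mulr_ge0.
have {}rn : r n * (2 * C + 1) < e / 2.
  by rewrite -ltr_pdivlMr // ltr_wpDl // mulr_ge0.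
have Crn : 0 <= C * r n by rewrite mulr_ge0.
have [|w [w1 w2]] := Sy n (e / 2); first by rewrite divr_gt0.
have := zr n; have := hl n => h1 h2; exists (z n + w); split.
  by have := nrmD hn (z n) w; lra.
have -> : T (z n + w) - (T x - l) = (T w - (T x - y n - T (z n))) + (l - y n).
  by rewrite (lin_mapD linT); ring.
have := nrmD hn (T w - (T x - y n - T (z n))) (l - y n).
by have := r0 n; lra.
Qed.

End ClosedGraph.

(** * The separating space of a derivation and the gliding hump *)

Section DerivationSeparating.
Variables (R : realType) (V : comAlgType R[i]) (nrm : V -> R).
Variable hn : complete_algebra_norm nrm.
Variable D : V -> V.
Hypothesis linD : forall (c : R[i]) x y, D (c *: x + y) = c *: D x + D y.
Hypothesis derM : forall x y, D (x * y) = D x * y + x * D y.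

Let sep := separating nrm D.

(** In [D (a * x) = D a * x + a * D x] the first term vanishes in the limit and the second tends to
    [a * s]. *)
Lemma separatingM a s : sep s -> sep (a * s).
Proof.
move=> hs e e0; set k := nrm a + nrm (D a).
have k0 : 0 <= k by rewrite addr_ge0 ?(nrm_ge0 hn).
have [|x [x1 x2]] := hs (e / (k + 1)); first by rewrite divr_gt0 // ltr_wpDl.
move: x1 x2; rewrite !ltr_pdivlMr ?ltr_wpDl // => x1 x2.
have a0 := nrm_ge0 hn a; have Da0 := nrm_ge0 hn (D a).
have nx0 := nrm_ge0 hn x; have nDx0 := nrm_ge0 hn (D x - s).
exists (a * x); split.
  by have := nrmM hn a x; rewrite /k in x1 x2; nra.
have -> : D (a * x) - a * s = D a * x + a * (D x - s) by rewrite derM; ring.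
have := nrmD hn (D a * x) (a * (D x - s)).
have := nrmM hn (D a) x; have := nrmM hn a (D x - s); rewrite /k in x1 x2.
set u := nrm (D x - s) in x2 nDx0 *; set v := nrm x in x1 nx0 *.
set p := nrm a in a0 x1 x2 *; set q := nrm (D a) in Da0 x1 x2 *.
have [uv|uv] := leP u v; nra.
Qed.

(** Closure of the multiples of [b] by the separating space. *)
Definition adherent b y :=
  forall e, 0 < e -> exists s, sep s /\ nrm (y - b * s) < e.

Lemma adherentZ (c : R) b y : c != 0 -> adherent b y -> adherent (c%:C *: b) y.
Proof.
move=> c0 h e /h [s [hs ys]]; exists (c^-1%:C *: s); split.
  exact: separatingZ.
by rewrite -scalerAl -scalerAr scalerA -rmorphM /= divff // scale1r.
Qed.

(** [b * s] keeps a distance [e] from the multiples of [a * b]. A large multiple of [s] amplifies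
    it, and a small [x] with [D x] near that multiple inherits it. *)
Let hump b a s M : sep s -> ~ adherent (a * b) (b * s) ->
  exists x, nrm x <= 1 /\ forall t, sep t -> M <= nrm (b * D x - a * b * t).
Proof.
move=> hs /existsNP [e /not_implyP [e0 he]].
have {}he t : sep t -> e <= nrm (b * s - a * b * t).
  by move=> ht; rewrite leNgt; apply/negP => h; apply: he; exists t.
(* The distance becomes at least [|M| + nrm b]; the part [nrm b] pays for replacing [c s] by [D x],
   at distance less than 1. *)
pose c := (`|M| + nrm b) / e + 1.
have b0 := nrm_ge0 hn b.
have c1 : c * e = `|M| + nrm b + e by rewrite /c mulrDl mul1r divfK // gt_eqF.
have c0 : 0 < c.
  rewrite /c; apply: ltr_wpDl => //.
  by apply: divr_ge0 (addr_ge0 _ _) (ltW e0).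
have [|x [x1 x2]] := separatingZ hn linD c%:C hs (e := 1) => //.
exists x; split; first exact: ltW.
move=> t ht.
have h1 : c * e <= nrm (b * (c%:C *: s) - a * b * t).
  have -> : b * (c%:C *: s) - a * b * t = c%:C *: (b * s - a * b * (c^-1%:C *: t)).
    rewrite scalerBr -!scalerAr scalerA -rmorphM /= divff ?scale1r //.
    by rewrite gt_eqF.
  rewrite (nrmZr hn) gtr0_norm // ler_pM2l //; apply: he.
  exact: separatingZ.
have h2 := nrm_tri hn (b * D x) (b * (c%:C *: s)) (a * b * t).
have : nrm (b * (c%:C *: s) - b * D x) <= nrm b * 1.
  by rewrite -mulrBr; apply: nrmM_le => //; rewrite nrmBC // ltW.
by have := ler_norm M; lra.
Qed.

(** The solution is [x n + a n x (n+1) + a n a (n+1) x (n+2) + ...], and [z m n] is its truncation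
    to [m] terms. *)
Let telescoped_series (a x : nat -> V) :
  (forall n, nrm (a n) <= 1 / 2) -> (forall n, nrm (x n) <= 1) ->
  exists y : nat -> V, forall n, nrm (y n) <= 2 /\ y n = x n + a n * y n.+1.
Proof.
move=> ha hx.
pose z := fix z m n : V := if m is k.+1 then x n + a n * z k n.+1 else 0.
pose r n := (2 : R) * 2^-1 ^+ n.
have [r0 rS] : (forall n, 0 <= r n) /\ (forall n, r n.+1 <= r n / 2).
  exact: half_pow_halving.
have dz m n : nrm (z m.+1 n - z m n) <= r m / 2.
  elim: m n => [|m IHm] n.
    by rewrite /= mulr0 addr0 subr0; apply: (le_trans (hx n)); rewrite /r expr0; lra.
  have -> : z m.+2 n - z m.+1 n = a n * (z m.+1 n.+1 - z m n.+1) by move=> /=; ring.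
  have := nrmM_le hn (ha n) (IHm n.+1).
  by rewrite /r exprS; lra.
have H n : exists l, forall m, nrm (l - z m n) <= r m.
  exact: (nrm_complete hn (u := fun m => z m n)).
have [y hy] := choice H; exists y => n; split.
  by have := hy n 0%N; rewrite /= subr0 /r expr0 mulr1.
apply/eqP; rewrite -subr_eq0; apply/eqP.
apply: (nrm_halving_eq0 hn r0 rS (c := 1)) => // m.
have -> : y n - (x n + a n * y n.+1) = (y n - z m.+1 n) - a n * (y n.+1 - z m n.+1).
  by move=> /=; ring.
have := nrmB hn (y n - z m.+1 n) (a n * (y n.+1 - z m n.+1)).
have := nrmM_le hn (ha n) (hy n.+1 m).
by have := hy n m.+1; have := rS m; have := r0 m; lra.
Qed.

(* Otherwise there are [a_n] along which the closures of [a_n ... a_1 S]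
   decrease strictly, and a gliding hump produces a vector whose image under
   [D] has norm at least [n] for every [n]. *)
Lemma minimal_separating :
  (exists s, sep s /\ s <> 0) ->
  exists b, (exists s, sep s /\ b * s <> 0) /\
    forall a, (forall s, sep s -> a * b * s = 0) \/
              (forall s, sep s -> adherent (a * b) (b * s)).
Proof.
move=> [s0 [ss0 s00]]; apply: contrapT => H.
have [K [K0 HK]] := dist_separating_bounded hn linD.
have {}H b : (exists s, sep s /\ b * s <> 0) -> exists a,
    [/\ nrm a <= 1 / 2, exists s, sep s /\ a * b * s <> 0 &
        exists s, sep s /\ ~ adherent (a * b) (b * s)].
  move=> hb; apply: contrapT => Ha; apply: H; exists b; split=> // a.
  apply: contrapT => /not_orP [/existsNP [s /not_implyP [ss abs]]].
  move=> /existsNP [t /not_implyP [st tb]].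
  (* Both properties of [a] survive scaling, so its norm may be brought below 1/2. *)
  pose c := (2 * (nrm a + 1))^-1; have a0 := nrm_ge0 hn a.
  have c0 : 0 < c by rewrite invr_gt0; lra.
  have cC : c != 0 by rewrite gt_eqF.
  apply: Ha; exists (c%:C *: a); split.
  - rewrite (nrmZr hn) gtr0_norm // /c mulrC ler_pdivrMr; lra.
  - exists s; split=> //; rewrite -!scalerAl => /(congr1 (fun v => c^-1%:C *: v)).
    by rewrite scaler0 scalerA -rmorphM /= mulVf // scale1r.
  exists t; split=> //; rewrite -scalerAl => h; apply: tb.
  have -> : a * b = c^-1%:C *: (c%:C *: (a * b)).
    by rewrite scalerA -rmorphM /= mulVf // scale1r.
  by apply: adherentZ => //; rewrite invr_eq0.
(* One summand for each term that separates [b n * D (x n)] from [D (y 0)] in the identity [E]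
   below, plus the target [n]. *)
pose M n b p ab := n%:R + nrm (D p) + nrm (D b) + 2 * nrm (D ab) + K * 2 * nrm ab.
have {}H (s : nat * V * V) : exists y : V * V,
    (exists s', sep s' /\ s.1.2 * s' <> 0) ->
    [/\ nrm y.1 <= 1 / 2, exists s', sep s' /\ y.1 * s.1.2 * s' <> 0, nrm y.2 <= 1 &
        forall t, sep t ->
        M s.1.1 s.1.2 s.2 (y.1 * s.1.2) <= nrm (s.1.2 * D y.2 - y.1 * s.1.2 * t)].
  case: s => -[n b] p /=.
  have [hb|hb] := pselect (exists s', sep s' /\ b * s' <> 0); last by exists (0, 0).
  have [a [a1 a2 [s [ss hs]]]] := H b hb.
  have [x [x1 x2]] := hump (M n b p (a * b)) ss hs.
  by exists (a, x) => _; split.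
have [f hf] := choice H.
(* [b n] is the product of the first [n] factors [a i], and [p n] the partial sum of the
   [b i * x i]; thus [y 0 = p n + b n * y n]. *)
pose st := fix st n : V * V := if n is m.+1 then
  let y := f (m, (st m).1, (st m).2) in (y.1 * (st m).1, (st m).2 + (st m).1 * y.2)
  else (1, 0).
pose b n := (st n).1; pose p n := (st n).2.
pose a n := (f (n, b n, p n)).1; pose x n := (f (n, b n, p n)).2.
have bn n : exists s', sep s' /\ b n * s' <> 0.
  elim: n => [|n IHn]; first by exists s0; rewrite /b /= mul1r.
  by have [_ h _ _] := hf (n, b n, p n) IHn.
have [y hy] : exists y : nat -> V, forall n, nrm (y n) <= 2 /\ y n = x n + a n * y n.+1.
  by apply: telescoped_series => n; have [] := hf (n, b n, p n) (bn n).
have yp n : y 0%N = p n + b n * y n.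
  elim: n => [|n IHn]; first by rewrite /p /b /= mul1r add0r.
  have [_ yn] := hy n; rewrite IHn yn /p /b /= -/(a n) -/(x n) -/(b n) -/(p n).
  ring.
have yn n : n%:R <= nrm (D (y 0%N)).
  have [_ _ x1] := hf (n, b n, p n) (bn n).
  rewrite /= -/(a n) -/(x n) in x1 *.
  have [t [ht]] := HK (y n.+1); have [y2 _] := hy n.+1 => Dy.
  move=> /(_ (- t)) h; have {}h : sep (- t) -> M n (b n) (p n) (b n.+1) <= _ := h.
  have {}h : M n (b n) (p n) (b n.+1) <= nrm (b n * D (x n) - b n.+1 * - t).
    apply: h; rewrite -sub0r; apply: separatingB => //; exact: separating0.
  have E : b n * D (x n) - b n.+1 * - t = D (y 0%N) - D (p n) - D (b n) * x n
      - (D (b n.+1) * y n.+1 + b n.+1 * (D (y n.+1) - t)).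
    rewrite (yp n.+1) (lin_mapD linD) derM.
    rewrite {1}/p /= -/(b n) -/(p n) -/(x n) (lin_mapD linD) derM.
    ring.
  move: h; rewrite E /M.
  have := nrmB hn (D (y 0%N) - D (p n) - D (b n) * x n)
    (D (b n.+1) * y n.+1 + b n.+1 * (D (y n.+1) - t)).
  have := nrmB hn (D (y 0%N) - D (p n)) (D (b n) * x n).
  have := nrmB hn (D (y 0%N)) (D (p n)).
  have := nrmD hn (D (b n.+1) * y n.+1) (b n.+1 * (D (y n.+1) - t)).
  have := nrmM_le hn (lexx (nrm (D (b n)))) x1.
  have := nrmM_le hn (lexx (nrm (D (b n.+1)))) y2.
  have := nrmM_le hn (lexx (nrm (b n.+1))) Dy.
  have : nrm (b n.+1) * (K * nrm (y n.+1)) <= nrm (b n.+1) * (K * 2).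
    by apply: ler_wpM2l; [exact: nrm_ge0 | apply: ler_wpM2l].
  lra.
have := yn (Num.bound (nrm (D (y 0%N)))).
by rewrite leNgt archi_boundP // nrm_ge0.
Qed.

End DerivationSeparating.

(** * The Gelfand-Mazur theorem *)

Lemma normc_ge0 (R : realType) (c : R[i]) : 0 <= Normc.normc c.
Proof. by case: c => a b; apply: sqrtr_ge0. Qed.

Lemma normcX (R : realType) (c : R[i]) n : Normc.normc (c ^+ n) = Normc.normc c ^+ n.
Proof.
elim: n => [|n IHn]; first by rewrite !expr0 Normc.normc1.
by rewrite !exprS Normc.normcM IHn.
Qed.

Lemma normc_le_sum (R : realType) (a b : R) : Normc.normc (a +i* b) <= `|a| + `|b|.
Proof.
rewrite /= -[leRHS]ger0_norm ?addr_ge0 // -sqrtr_sqr ler_wsqrtr //.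
rewrite sqrrD !real_normK ?num_real // mulr2n.
by have := mulr_ge0 (normr_ge0 a) (normr_ge0 b); lra.
Qed.

Lemma normc_ge_parts (R : realType) (a b : R) :
  `|a| <= Normc.normc (a +i* b) /\ `|b| <= Normc.normc (a +i* b).
Proof.
by rewrite /= -!sqrtr_sqr !ler_wsqrtr // ?lerDl ?lerDr sqr_ge0.
Qed.

(** Compactness in its near-covering form, the parameter being a bound that tends to infinity. *)
Lemma locally_bounded_square (R : realType) (g : R * R -> R) (rho : R) :
  (forall p, exists e M, 0 < e /\
     forall q, `|q.1 - p.1| < e -> `|q.2 - p.2| < e -> g q <= M) ->
  exists M, forall p, `|p.1| <= rho -> `|p.2| <= rho -> g p <= M.
Proof.
move=> hg.
have /compact_near_coveringP H := compact_setX (@segment_compact R (- rho) rho)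
  (@segment_compact R (- rho) rho).
have [p _|M0 [_ HM]] := H R (pinfty_nbhs R) (fun M p => g p <= M) _.
  have [e [M [e0 hM]]] := hg p.
  exists (ball p e, [set N | M < N]); first split => /=.
  - exact: nbhsx_ballx.
  - by exists M; split=> //; rewrite num_real.
  move=> [q N] /= [[q1 q2] MN]; apply: le_trans (ltW MN).
  by apply: hM; rewrite distrC.
exists (M0 + 1) => p p1 p2; apply: (HM (M0 + 1)); first by rewrite ltrDl.
by split; rewrite /= in_itv /= -ler_norml.
Qed.

Lemma root_of_minus_one (R : realType) (n : nat) : (0 < n)%N ->
  exists eta : R[i], eta ^+ n = -1 /\ Normc.normc eta = 1.
Proof.
move=> n0; exists (n.-root (-1)); rewrite rootCK //; split=> //.
apply/eqP; have := normcX (n.-root (-1 : R[i])) n.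
rewrite rootCK // -(rmorphN1 (real_complex R)) normc_real normrN1 => /esym/eqP.
by rewrite pexprn_eq1 ?normc_ge0 // gtn_eqF.
Qed.

Section GelfandMazur.
Variables (R : realType) (V : comAlgType R[i]) (nrm : V -> R).
Variable hn : complete_algebra_norm nrm.
Variable f : V.
Hypothesis ff : f * f = f.
Hypothesis f_neq0 : f <> 0.
Hypothesis f_field : forall x, x * f = 0 \/ exists y, y * x * f = f.

Let nf : 1 <= nrm f.
Proof.
have := nrmM hn f f; rewrite ff => h; have := nrm_gt0 hn f_neq0.
by move=> f0; rewrite -(ler_pM2l f0) mulr1.
Qed.

Section EmptySpectrum.
Variable x : V.
Hypothesis xf : x * f = x.
Hypothesis x_not_scalar : forall c : R[i], x <> c *: f.

Let fX n : f ^+ n.+1 = f.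
Proof. by elim: n => [|n IHn]; rewrite ?expr1 // exprS IHn. Qed.

Let xnf n : x ^+ n.+1 * f = x ^+ n.+1.
Proof. by rewrite exprSr -mulrA xf. Qed.

(** For nonzero [c], [x - c^-1 f] is nonzero in the field [fV], hence invertible there. *)
Let resolvent (c : R[i]) : exists y, y * f = y /\ y * (f - c *: x) = f.
Proof.
have [->|c0] := eqVneq c 0; first by exists f; rewrite scale0r subr0.
have [h|[y hy]] := f_field (x - c^-1 *: f).
  case: (x_not_scalar (c := c^-1)); apply/eqP; rewrite -subr_eq0 -h.
  by rewrite mulrBl xf -scalerAl ff.
exists (- c^-1 *: (y * f)); split; first by rewrite -scalerAl -mulrA ff.
have hy' : y * x * f = f + c^-1 *: (y * f).
  by rewrite -[X in X + _]hy mulrBr mulrBl -scalerAr -scalerAl -(mulrA y f f) ff subrK.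
have -> : (- c^-1 *: (y * f)) * (f - c *: x) =
  (c^-1 * c) *: (y * x * f) - c^-1 *: (y * (f * f)).
  rewrite mulrBr -!scalerAl -scalerAr scalerA mulNr !scaleNr opprK addrC.
  by rewrite (mulrAC y f x) mulrA.
by rewrite mulVf // scale1r hy' ff addrK.
Qed.

(** The resolvent identity [dG] gives local boundedness, compactness makes it uniform, and the
    identity then yields the Lipschitz constant. *)
Let resolvent_square rho :
  exists (G : R[i] -> V) L, 0 <= L /\
  (forall c, G c * f = G c /\ G c * (f - c *: x) = f) /\
  forall c d, Normc.normc c <= rho -> Normc.normc d <= rho ->
    nrm (G c - G d) <= L * Normc.normc (c - d).
Proof.
have [G hG] := choice resolvent.
have dG c d : G c - G d = (c - d) *: (x * G c * G d).
  have [c1 c2] := hG c; have [d1 d2] := hG d.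
  transitivity (G c * (G d * (f - d *: x)) - G d * (G c * (f - c *: x))).
    by rewrite d2 c1 c2 d1.
  by rewrite scalerBl !scalerAl; ring.
have dGn c d : nrm (G c - G d) <= Normc.normc (c - d) * (nrm x * nrm (G c) * nrm (G d)).
  rewrite dG (nrmZ hn); apply: ler_wpM2l; first exact: normc_ge0.
  by apply: nrmM_le => //; exact: nrmM_le.
have [M hM] : exists M, forall p : R * R, `|p.1| <= rho -> `|p.2| <= rho ->
    nrm (G (p.1 +i* p.2)) <= M.
  apply: locally_bounded_square => -[a b].
  set d := a +i* b; pose k := nrm x * nrm (G d).
  have k0 : 0 <= k by rewrite mulr_ge0 ?(nrm_ge0 hn).
  (* Within this radius [|c - d| k <= 1/2], so the identity gives
     [nrm (G c) <= nrm (G d) + nrm (G c) / 2]. *)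
  exists (1 / 4 / (k + 1)), (2 * nrm (G d)); split; first by rewrite !divr_gt0 // ltr_wpDl.
  move=> [a' b'] /=; set c := a' +i* b' => h1 h2.
  have hc : Normc.normc (c - d) <= 1 / 2 / (k + 1).
    by have := normc_le_sum (a' - a) (b' - b); rewrite /c /d /=; lra.
  have {}hc : Normc.normc (c - d) * (k + 1) <= 1 / 2.
    by rewrite -ler_pdivlMr // ltr_wpDl.
  have := dGn c d; have := nrmD hn (G c - G d) (G d); rewrite subrK.
  have := normc_ge0 (c - d); have := nrm_ge0 hn (G c).
  set u := nrm (G c); set v := Normc.normc _ in hc *; move=> u0 v0 h3 h4.
  have : v * (nrm x * u * nrm (G d)) <= 1 / 2 * u.
    have -> : v * (nrm x * u * nrm (G d)) = (v * k) * u by rewrite /k; ring.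
    by apply: ler_wpM2r => //; lra.
  lra.
exists G, (nrm x * M * M).
have hM' c : Normc.normc c <= rho -> nrm (G c) <= `|M|.
  case: c => a b h; have [h1 h2] := normc_ge_parts a b.
  apply: le_trans (ler_norm _); apply: (hM (a, b)) => /=; exact: le_trans h.
split; first by rewrite -mulrA mulr_ge0 ?(nrm_ge0 hn) // -expr2 sqr_ge0.
split=> // c d hc hd; apply: (le_trans (dGn c d)).
rewrite mulrC ler_wpM2r ?normc_ge0 //.
have -> : nrm x * M * M = nrm x * `|M| * `|M|.
  by rewrite -!mulrA -[`|M| * _]normrM ger0_norm // -expr2 sqr_ge0.
apply: ler_pM; rewrite ?mulr_ge0 ?(nrm_ge0 hn) ?hM' //.
by apply: ler_pM; rewrite ?(nrm_ge0 hn) ?hM'.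
Qed.

(* [G c] is the average of the resolvents [(f - w c x)^-1] over the [2 ^ k]-th
   roots of unity [w], so the Lipschitz constant does not depend on [k]. *)
Let averaged_resolvents rho : exists L, 0 <= L /\ forall k, exists G : R[i] -> V,
  (forall c, G c * f = G c /\ G c * (f - c ^+ (2 ^ k) *: x ^+ (2 ^ k)) = f) /\
  forall c r s, Normc.normc c = 1 -> 0 <= r <= rho -> 0 <= s <= rho ->
    nrm (G (r%:C * c) - G (s%:C * c)) <= L * `|r - s|.
Proof.
have [G0 [L [L0 [hG0 lip]]]] := resolvent_square rho.
exists L; split=> // k; elim: k => [|k [G [hG lipG]]].
  exists G0; split=> [c|c r s c1 /andP[r0 r1] /andP[s0 s1]]; first exact: hG0.
  apply: (le_trans (lip _ _ _ _)).
  - by rewrite Normc.normcM c1 mulr1 normc_real ger0_norm.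
  - by rewrite Normc.normcM c1 mulr1 normc_real ger0_norm.
  by rewrite -mulrBl -rmorphB Normc.normcM c1 mulr1 normc_real.
(* Multiplying [c] by [eta] changes the sign of [z = c^(2^k) x^(2^k)], and the mean of the inverses
   of [f - z] and [f + z] is the inverse of [f - z^2]. *)
have [eta [eta1 eta2]] := @root_of_minus_one R (2 ^ k) (expn_gt0 2 k).
exists (fun c => (2^-1)%:C *: (G c + G (eta * c))); split=> [c|c r s c1 hr hs].
  have [c1 c2] := hG c; have [d1 d2] := hG (eta * c).
  rewrite -scalerAl mulrDl c1 d1; split=> //.
  rewrite expnS mulnC !exprM.
  move: c2 d2; rewrite exprMn eta1 mulN1r scaleNr opprK -(exprZn (c ^+ (2 ^ k))).
  set z := c ^+ (2 ^ k) *: _ => c2 d2.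
  have -> : f - z ^+ 2 = (f - z) * (f + z).
    by transitivity (f * f - z ^+ 2); [rewrite ff | ring].
  rewrite -scalerAl mulrDl mulrA c2 (mulrC (f - z)) mulrA d2 -mulrDr.
  have -> : f + z + (f - z) = 2%:R *: f by rewrite scaler_nat; ring.
  rewrite -scalerAr ff scalerA -(rmorph_nat (real_complex R)) -rmorphM /= mulVf //.
  by rewrite scale1r.
rewrite -scalerBr (nrmZr hn) ger0_norm ?invr_ge0 //.
have -> : G (r%:C * c) + G (eta * (r%:C * c)) - (G (s%:C * c) + G (eta * (s%:C * c))) =
  (G (r%:C * c) - G (s%:C * c)) + (G (r%:C * (eta * c)) - G (s%:C * (eta * c))).
  by rewrite ![eta * (_ * c)]mulrCA; ring.
have := nrmD hn (G (r%:C * c) - G (s%:C * c)) (G (r%:C * (eta * c)) - G (s%:C * (eta * c))).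
have := lipG c r s c1 hr hs.
have := lipG (eta * c) r s _ hr hs; rewrite Normc.normcM c1 eta2 mul1r => /(_ erefl).
lra.
Qed.

(** For [r >= 0] this is the norm of [(r x)^(2^k)]; it is at most 1/2 for some [k] exactly when
    [r x] has spectral radius below 1. *)
Let h k r := r ^+ (2 ^ k) * nrm (x ^+ (2 ^ k)).

Let h_ge0 k r : 0 <= r -> 0 <= h k r.
Proof. by move=> r0; rewrite mulr_ge0 ?exprn_ge0 ?(nrm_ge0 hn). Qed.

Let hS k r : 0 <= r -> h k.+1 r <= h k r ^+ 2.
Proof.
move=> r0; rewrite /h expnS mulnC !exprM exprMn ler_wpM2l ?exprn_ge0 //.
by rewrite !expr2 nrmM.
Qed.

Let h_small k r : 0 <= r -> h k r <= 1 / 2 -> forall e, 0 < e -> exists j, h j r < e.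
Proof.
move=> r0 hk e e0.
have hj j : h (j + k) r <= 1 / 2.
  elim: j => [|j IHj] //; rewrite addSn; apply: (le_trans (hS _ r0)).
  by have := h_ge0 (j + k) r0; rewrite expr2; nra.
have [j|j|j hje] := halving_small (r := fun j => h (j + k) r) _ _ e0.
- exact: h_ge0.
- rewrite addSn; apply: (le_trans (hS _ r0)).
  by have := h_ge0 (j + k) r0; have := hj j; rewrite expr2; nra.
by exists (j + k)%N.
Qed.

(** The condition [E] holds at 0 and propagates in steps of a fixed length up to [rho], the norm of
    the inverse [xi] of [x]. It fails there: [1 <= nrm f <= rho^n nrm (x^n)], as [f = xi^n x^n] for
    n > 0. *)
Lemma empty_spectrum_absurd : False.
Proof.
have [xi hxi] : exists xi, xi * x = f.
  have [h0|[y hy]] := f_field x.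
    by case: (x_not_scalar (c := 0)); rewrite scale0r -xf.
  by exists y; rewrite -[x]xf mulrA.
have xi0 : xi <> 0 by move=> xi0; apply: f_neq0; rewrite -hxi xi0 mul0r.
set rho := nrm xi; have rho0 : 0 < rho by exact: nrm_gt0.
have [L [L0 HL]] := averaged_resolvents rho.
pose E r := exists k, h k r <= 1 / 2.
(* For suitable [k] the resolvent [u] at [r] is near [f]; by the Lipschitz bound so is the resolvent
   [w] at [s], and [ys = (w - f)(f - ys)] is then small. *)
have Estep r s : 0 <= r -> r <= s -> s <= rho -> L * (s - r) * (8 * nrm f) <= 1 ->
    E r -> E s.
  move=> r0 rs s1 hL [k0 hk0].
  have nf0 : 0 < nrm f by have := nf; lra.
  have s0 : 0 <= s by lra.
  (* This leaves [nrm (u - f)] and [nrm (u - w)] at most [1 / (8 nrm f)] each; the bound obtained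
     for [h k s] is 1/3. *)
  have [|k hk] := h_small r0 hk0 (e := (16 * nrm f)^-1).
    by rewrite invr_gt0 mulr_gt0.
  have {}hk : h k r * (16 * nrm f) <= 1.
    by rewrite -ler_pdivlMr ?mulr_gt0 // div1r ltW.
  exists k; have [G [hG lipG]] := HL k.
  have Xf : x ^+ (2 ^ k) * f = x ^+ (2 ^ k).
    by rewrite -(prednK (expn_gt0 2 k)) xnf.
  have hr0 : 0 <= h k r := h_ge0 k r0.
  have hs0 : 0 <= h k s := h_ge0 k s0.
  have hN t : 0 <= t -> h k t = nrm (t%:C ^+ (2 ^ k) *: x ^+ (2 ^ k)).
    by move=> t0; rewrite -rmorphXn (nrmZr hn) ger0_norm ?exprn_ge0.
  have [u1 u2] := hG r%:C; have [w1 w2] := hG s%:C.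
  move: u1 u2 w1 w2 (hN r r0) (hN s s0).
  set yr := r%:C ^+ _ *: _; set ys := s%:C ^+ _ *: _; set u := G r%:C; set w := G s%:C.
  move=> u1 u2 w1 w2 hyr hys.
  have yrf : yr * f = yr by rewrite -scalerAl Xf.
  have ysf : ys * f = ys by rewrite -scalerAl Xf.
  have du : nrm (u - f) <= 2 * h k r.
    have E1 : u - f = (u - f) * yr + yr.
      by rewrite mulrBl [f * yr]mulrC yrf subrK -{1}u2 mulrBr u1; ring.
    have := nrmD hn ((u - f) * yr) yr; rewrite -E1 -hyr.
    have := nrmM hn (u - f) yr; rewrite -hyr.
    have := nrm_ge0 hn (u - f); set a := nrm (u - f) => a0 h1 h2.
    have h3 : h k r * 1 <= h k r * nrm f by apply: ler_wpM2l => //; exact: nf.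
    have : a * h k r <= a * (1 / 2) by apply: ler_wpM2l => //; lra.
    lra.
  have duw : nrm (u - w) <= L * (s - r).
    have := lipG 1 r s (Normc.normc1 R); rewrite !mulr1 distrC ger0_norm ?subr_ge0 //.
    by apply; apply/andP; split=> //; lra.
  have dw : nrm (w - f) * (4 * nrm f) <= 1.
    have := nrm_tri hn u w f; rewrite (nrmBC hn w u) => h1.
    have : nrm (w - f) * (4 * nrm f) <= (L * (s - r) + 2 * h k r) * (4 * nrm f).
      by apply: ler_wpM2r; [rewrite mulr_ge0 // ltW | lra].
    lra.
  have E2 : ys = (w - f) * (f - ys).
    by rewrite mulrBl w2 mulrBr ff [f * ys]mulrC ysf; ring.
  have := nrmM hn (w - f) (f - ys); rewrite -E2 -hys.
  have := nrmB hn f ys; rewrite -hys.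
  have := nrm_ge0 hn (w - f); have := nrm_ge0 hn (f - ys).
  set p := nrm (w - f) in dw *; set q := nrm (f - ys) => q0 p0 qle hle.
  have : p * q <= p * (nrm f + h k s) by apply: ler_wpM2l.
  have : p * h k s <= p * nrm f * h k s.
    by apply: ler_wpM2r => //; rewrite ler_peMr.
  nra.
(* Steps of length [rho / J] meet the condition of [Estep]. *)
pose J := (Num.bound (L * rho * (8 * nrm f))).+1.
have J0 : 0 < J%:R :> R by rewrite ltr0n.
have Jbound : L * rho * (8 * nrm f) <= J%:R.
  apply: ltW; apply: lt_le_trans (archi_boundP _) _; last by rewrite ler_nat.
  by apply: mulr_ge0; [exact: mulr_ge0 (ltW _) | have := nf; lra].
have EJ j : (j <= J)%N -> E (j%:R / J%:R * rho).
  elim: j => [|j IHj] jJ.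
    by exists 0%N; rewrite /h !mul0r; lra.
  have jJ' : j.+1%:R <= J%:R :> R by rewrite ler_nat.
  apply: Estep (IHj (ltnW jJ)).
  - by rewrite mulr_ge0 ?divr_ge0 // ltW.
  - by rewrite ler_wpM2r ?(ltW rho0) // ler_wpM2r ?invr_ge0 // ler_nat.
  - by rewrite ger_pMl // ler_pdivrMr // mul1r.
  have -> : L * (j.+1%:R / J%:R * rho - j%:R / J%:R * rho) * (8 * nrm f) =
      L * rho * (8 * nrm f) / J%:R.
    by rewrite -(natr1 j); field; rewrite gt_eqF.
  by rewrite ler_pdivrMr // mul1r.
have := EJ J (leqnn J); rewrite divff ?gt_eqF // mul1r => -[k].
suff : 1 <= h k rho by lra.
apply: (le_trans nf).
have := expn_gt0 2 k; rewrite /h; case: (2 ^ k)%N => // n _.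
have -> : f = xi ^+ n.+1 * x ^+ n.+1 by rewrite -exprMn hxi fX.
by apply: nrmM_le => //; exact: (nrmX_le hn).
Qed.

End EmptySpectrum.

Lemma gelfand_mazur (x : V) : exists c : R[i], x * f = c *: f.
Proof.
apply: contrapT => H; apply: (@empty_spectrum_absurd (x * f)).
  by rewrite -mulrA ff.
by move=> c h; apply: H; exists c.
Qed.

End GelfandMazur.

(** Beyond an index larger than [2 c], each step at least halves [c^n / n!]. *)
Lemma pow_fact_small (R : realType) (c e : R) :
  0 <= c -> 0 < e -> exists n, c ^+ n < e * n`!%:R.
Proof.
move=> c0 e0; set m := Num.bound (2 * c).
have hm : 2 * c < m%:R by apply: archi_boundP; rewrite mulr_ge0.
pose r n := c ^+ (m + n) / (m + n)`!%:R.
have f0 n : 0 < n`!%:R :> R by rewrite ltr0n fact_gt0.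
have [n|n|n hr] := halving_small (r := r) _ _ e0.
- by rewrite divr_ge0 ?exprn_ge0.
- rewrite /r addnS exprS factS natrM invfM.
  have -> : c * c ^+ (m + n) * ((m + n).+1%:R^-1 / (m + n)`!%:R) =
    c ^+ (m + n) / (m + n)`!%:R * (c / (m + n).+1%:R) by ring.
  apply: ler_wpM2l; first by rewrite divr_ge0 ?exprn_ge0.
  rewrite ler_pdivrMr ?ltr0n // -(natr1 (m + n)) natrD.
  by have : (0 : R) <= n%:R by []; lra.
by exists (m + n)%N; rewrite -ltr_pdivrMr.
Qed.

(** * Derivations of semisimple commutative Banach algebras *)

Section SemisimpleDerivation.
Variables (R : realType) (V : comAlgType R[i]) (nrm : V -> R).
Variable hn : complete_algebra_norm nrm.
Hypothesis semisimple : forall x : V, (forall y, exists z, (1 - y * x) * z = 1) -> x = 0.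
Variable D : V -> V.
Hypothesis linD : forall (c : R[i]) x y, D (c *: x + y) = c *: D x + D y.
Hypothesis derM : forall x y, D (x * y) = D x * y + x * D y.

Let sep := separating nrm D.

(** By semisimplicity some multiple [f] of [b * s0] has [1 - f] not invertible. The dichotomy for
    [1 - f] makes [f] act as the identity on [bS]; applied to any [x], it makes [fV] a field. *)
Let separating_idempotent : (exists s, sep s /\ s <> 0) ->
  exists f, [/\ sep f, f <> 0, f * f = f &
    forall x, x * f = 0 \/ exists y, y * x * f = f].
Proof.
move=> /(minimal_separating hn linD derM) [b [[s0 [ss0 bs0]] minb]].
have [y hy] : exists y, forall z, (1 - y * (b * s0)) * z <> 1.
  apply: contrapT => h; apply: bs0; apply: semisimple => y.
  by apply: contrapT => h2; apply: h; exists y => z hz; apply: h2; exists z.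
pose s1 := y * s0; have ss1 : sep s1 by exact: separatingM.
pose f := b * s1; have fE : f = y * (b * s0) by rewrite /f /s1 mulrCA.
rewrite -fE in hy.
have fid s : sep s -> f * (b * s) = b * s.
  case: (minb (1 - f)) => [h ss|h _].
    have := h _ ss; rewrite !mulrBl mul1r => /eqP; rewrite subr_eq0 => /eqP E.
    by rewrite mulrA -E.
  (* In the dense case [(1 - f)(1 + b s')] is within 1/2 of 1, so [1 - f] would be invertible. *)
  have [|s' [_ hs']] := h s1 ss1 (1 / 2); first by rewrite divr_gt0.
  have [|w hw] := near_one_inv hn (x := (1 - f) * (1 + b * s')).
    have -> : 1 - (1 - f) * (1 + b * s') = b * s1 - (1 - f) * b * s' by rewrite /f; ring.
    exact: (ltW hs').
  by case: (hy ((1 + b * s') * w)); rewrite mulrA.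
have ff : f * f = f by exact: fid.
exists f; split=> //.
- exact: separatingM.
- by move=> f0; apply: (hy 1); rewrite f0 subr0 mulr1.
move=> x; case: (minb x) => [h|h]; first by left; rewrite /f mulrA h.
right; have [|s [ss hs]] := h s1 ss1 (1 / 2); first by rewrite divr_gt0.
have [|w hw] := near_one_inv hn (x := 1 - (f - x * b * s)).
  by rewrite subKr ltW.
(* [x b s] is near [f], so [w] corrects [b s] to an exact inverse of [x] in [fV]. *)
exists (b * s * w).
have -> : b * s * w * x * f = x * (f * (b * s)) * w by ring.
rewrite fid //; transitivity (f * ((1 - (f - x * b * s)) * w)); last by rewrite hw mulr1.
have -> : f * ((1 - (f - x * b * s)) * w) = (f - f * f + x * (f * (b * s))) * w by ring.
by rewrite ff subrr add0r fid.
Qed.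

Let separating_eq0 s : sep s -> s = 0.
Proof.
move=> ss; apply: contrapT => s0.
have [|f [sf f0 ff ffield]] := separating_idempotent; first by exists s.
have fDf : f * D f = 0.
  have E : D f = D f * f + f * D f by rewrite -derM ff.
  have := congr1 ( *%R f) E.
  have -> : f * (D f * f + f * D f) = f * f * D f + f * f * D f by ring.
  rewrite ff => /eqP.
  by rewrite -[X in X == _]addr0 (inj_eq (addrI _)) eq_sym => /eqP.
have Df : D f = 0 by have := derM f f; rewrite ff mulrC fDf addr0.
have fD x : f * D x = 0.
  have [c hc] := gelfand_mazur hn ff f0 ffield x.
  by have := derM x f; rewrite hc (lin_mapZ linD) Df scaler0 mulr0 addr0 mulrC.
(* Multiplying [D x - f] by [f] gives [-f], whence [nrm f <= nrm f / 2]. *)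
have [|x [_ hx]] := sf (1 / 2); first by rewrite divr_gt0.
have := nrmM hn f (D x - f); rewrite mulrBr fD ff sub0r (nrmN hn).
have := nrm_gt0 hn f0; have := nrm_ge0 hn (D x - f); nra.
Qed.

Let derivation_bounded : exists K, 0 <= K /\ forall x, nrm (D x) <= K * nrm x.
Proof.
have [K [K0 HK]] := dist_separating_bounded hn linD.
exists K; split=> // x; have [s [ss]] := HK x.
by rewrite (separating_eq0 ss) subr0.
Qed.

Let ad a (U : V -> V) (x : V) := U (a * x) - a * U x.

Let ad_iterS a n U x :
  iter n.+1 (ad a) U x = iter n (ad a) U (a * x) - a * iter n (ad a) U x.
Proof. by []. Qed.

(* [ad a] is a derivation on operators that maps [D] to multiplication by
   [D a] and kills multiplications. *)
Let ad_comp a (W Z : nat -> V -> V) :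
  (forall n x, W n.+1 x = W n (a * x) - a * W n x) ->
  (forall n x, Z n.+1 x = Z n (a * x) - a * Z n x) ->
  (forall x, Z 0%N x = D (W 0%N x)) ->
  forall n x, Z n.+1 x = D (W n.+1 x) + n.+1%:R * (D a * W n x).
Proof.
move=> WS ZS Z0; elim=> [|n IHn] x.
  by rewrite ZS !Z0 WS (lin_mapB linD) derM; ring.
rewrite ZS !IHn (WS n.+1 x) (lin_mapB linD) derM -(natr1 n.+1) (WS n x).
ring.
Qed.

Let ad_iter_comp a n U x : iter n.+1 (ad a) (D \o U) x =
  D (iter n.+1 (ad a) U x) + n.+1%:R * (D a * iter n (ad a) U x).
Proof.
exact: (ad_comp (W := fun n => iter n (ad a) U) (Z := fun n => iter n (ad a) (D \o U))).
Qed.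

(** The second clause is carried through the induction because it kills the term
    [D (ad^(n+1) (D^n))] in the expansion of [ad^(n+1) (D^(n+1))]. *)
Let ad_iter_pow a n : (forall x, iter n (ad a) (iter n D) x = n`!%:R * (D a ^+ n * x)) /\
  forall x, iter n.+1 (ad a) (iter n D) x = 0.
Proof.
elim: n => [|n [IH0 IH1]].
  by split=> x; rewrite /= ?expr0 ?mul1r // /ad subrr.
have E : iter n.+1 D = D \o iter n D by [].
have H x : iter n.+1 (ad a) (iter n.+1 D) x = n.+1`!%:R * (D a ^+ n.+1 * x).
  rewrite E ad_iter_comp IH1 (lin_map0 linD) IH0 factS natrM exprS; ring.
split=> // x; rewrite E ad_iter_comp IH1 mulr0 mulr0 addr0 ad_iterS !IH1.
by rewrite mulr0 subrr (lin_map0 linD).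
Qed.

(** Evaluate the identity at 1: each [ad a] costs a factor [2 nrm a], each [D] a factor [K]. *)
Let derivation_pow_bound : exists K, 0 <= K /\ forall a n,
  n`!%:R * nrm (D a ^+ n) <= (K * nrm a) ^+ n * nrm 1.
Proof.
have [K [K0 hK]] := derivation_bounded; exists (2 * K); split; first by rewrite mulr_ge0.
move=> a n; have a0 := nrm_ge0 hn a.
have hD m x : nrm (iter m D x) <= K ^+ m * nrm x.
  elim: m => [|m IHm]; first by rewrite expr0 mul1r.
  apply: (le_trans (hK _)); rewrite exprS -mulrA; exact: ler_wpM2l.
have had m x : nrm (iter m (ad a) (iter n D) x) <= (2 * nrm a) ^+ m * K ^+ n * nrm x.
  elim: m x => [|m IHm] x; first by rewrite expr0 mul1r hD.
  rewrite ad_iterS; apply: (le_trans (nrmB hn _ _)).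
  have c0 : 0 <= (2 * nrm a) ^+ m * K ^+ n by rewrite mulr_ge0 ?exprn_ge0 ?mulr_ge0.
  have h1 := ler_wpM2l c0 (nrmM hn a x).
  have h2 := nrmM_le hn (lexx (nrm a)) (IHm x).
  have h3 := IHm (a * x); rewrite exprS; lra.
have := had n 1; have [-> _] := ad_iter_pow a n.
rewrite mulr1 -scaler_nat -scalerAl mul1r.
have -> : n`!%:R = (n`!%:R : R)%:C by rewrite rmorph_nat.
rewrite (nrmZr hn) ger0_norm // => h; apply: (le_trans h).
by rewrite -exprMn le_eqVlt; apply/orP; left; apply/eqP; congr (_ ^+ _ * _); ring.
Qed.

Lemma semisimple_derivation_eq0 a : D a = 0.
Proof.
have [K [K0 hK]] := derivation_pow_bound.
apply: semisimple => c; set b := c * D a.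
have n1 := nrm_ge0 hn 1; have c0 := nrm_ge0 hn c; have a0 := nrm_ge0 hn a.
set N := nrm 1 in n1 hK; have NN : 0 <= N * N by exact: mulr_ge0.
have N1 : 0 < 2 * (N * N + 1) by lra.
(* This tolerance gives [nrm (b^n) <= 1/2]; one factor [nrm 1] comes from each of the powers of [c]
   and [D a]. *)
have [|n] := pow_fact_small (mulr_ge0 c0 (mulr_ge0 K0 a0)) (e := (2 * (N * N + 1))^-1).
  by rewrite invr_gt0.
rewrite [ltRHS]mulrC ltr_pdivlMr // => hnf.
have cX : nrm (c ^+ n) <= nrm c ^+ n * N.
  elim: (n) => [|m IHm]; first by rewrite !expr0 mul1r.
  by rewrite !exprS -mulrA; exact: nrmM_le.
have [|y hy] := neumann hn (x := b ^+ n).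
  have f0 : 0 < n`!%:R :> R by rewrite ltr0n fact_gt0.
  rewrite -(ler_pM2l f0) exprMn.
  have h1 := ler_wpM2l (ltW f0) (nrmM hn (c ^+ n) (D a ^+ n)).
  have h2 := ler_pM (nrm_ge0 hn _) (mulr_ge0 (ltW f0) (nrm_ge0 hn _)) cX (hK a n).
  move: hnf h2; rewrite exprMn => hnf h2.
  have q0 : 0 <= nrm c ^+ n * (K * nrm a) ^+ n.
    by rewrite mulr_ge0 ?exprn_ge0 ?mulr_ge0.
  lra.
(* [1 - b] divides the invertible element [1 - b^n]. *)
exists ((\sum_(i < n) b ^+ i) * y).
by rewrite mulrA -[X in X * y]opprK -mulNr opprB -subrX1 opprB.
Qed.

End SemisimpleDerivation.

(** * The corner algebra of a right identity *)

Section RealNorm.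
Variables (R : realType) (A : completeNormedModType R[i]).

(** The norm of [A] lies in [R[i]] with zero imaginary part; this is the same number in [R]. *)
Definition rnorm (x : A) : R := complex.Re `|x|.

Lemma rnormE x : `|x| = (rnorm x)%:C.
Proof.
have := normr_ge0 x; rewrite /rnorm; case: `|x| => a b.
by rewrite lecE /= => /andP[/eqP-> _].
Qed.

Lemma rnormD x y : rnorm (x + y) <= rnorm x + rnorm y.
Proof. by rewrite -lecR rmorphD /= -!rnormE ler_normD. Qed.

Lemma rnormN x : rnorm (- x) = rnorm x.
Proof. by rewrite /rnorm normrN. Qed.

Lemma rnormZ (c : R[i]) x : rnorm (c *: x) = Normc.normc c * rnorm x.
Proof. by apply: complexI; rewrite -rnormE normrZ rmorphM /= -rnormE. Qed.

Lemma rnorm0_eq0 x : rnorm x = 0 -> x = 0.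
Proof. by move=> h; apply/eqP; rewrite -normr_eq0 rnormE h. Qed.

Lemma rnorm_complete (u : nat -> A) (r : nat -> R) :
  (forall n, 0 <= r n) -> (forall n, r n.+1 <= r n / 2) ->
  (forall n, rnorm (u n.+1 - u n) <= r n / 2) ->
  exists l, forall n, rnorm (l - u n) <= r n.
Proof.
move=> r0 rS ur.
(* The difference on the right absorbs each increment, since [r n / 2 <= r n - r (n+1)]. *)
have udist n m : rnorm (u (m + n)%N - u n) <= r n - r (m + n)%N.
  elim: m => [|m IHm]; first by rewrite !subrr /rnorm normr0.
  rewrite addSn; have := rnormD (u (m + n).+1 - u (m + n)%N) (u (m + n)%N - u n).
  rewrite addrA subrK; have := ur (m + n)%N; have := rS (m + n)%N; lra.
have udist' n m : (n <= m)%N -> rnorm (u m - u n) <= r n.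
  by move=> nm; have := udist n (m - n)%N; rewrite subnK // => h; have := r0 m; lra.
have cu : cvgn u.
  apply/cauchy_cvgP/cauchyP => -[e e']; rewrite ltcE /= => /andP[/eqP -> e0].
  have [n rn] := halving_small r0 rS e0.
  exists (u n); exists n => // m /= nm.
  rewrite -ball_normE /= distrC rnormE ltcR; apply: le_lt_trans rn; exact: udist'.
exists (limn u) => n; apply/ler_addgt0Pl => e e0.
have /cvgrPdist_lt /(_ e%:C) [|N _ hN] := cu; first by rewrite ltcR.
have := hN (maxn n N) (leq_maxr _ _) => /=; rewrite rnormE ltcR => h.
have := udist' n (maxn n N) (leq_maxl _ _).
have := rnormD (limn u - u (maxn n N)) (u (maxn n N) - u n).
by rewrite addrA subrK; lra.
Qed.

End RealNorm.

Section CornerAlgebra.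
Variables (R : realType) (A : completeNormedModType R[i]) (mul : A -> A -> A).
Variable hA : banach_algebra_mul mul.

Lemma bmulA x y z : mul x (mul y z) = mul (mul x y) z. Proof. by case: hA. Qed.

Lemma bmul_linl (c : R[i]) x y z : mul (c *: x + y) z = c *: mul x z + mul y z.
Proof. by case: hA. Qed.

Lemma bmul_linr (c : R[i]) x y z : mul z (c *: x + y) = c *: mul z x + mul z y.
Proof. by case: hA. Qed.

Lemma bmul0l x : mul 0 x = 0. Proof. exact: (lin_map0 (fun c y z => bmul_linl c y z x)). Qed.

Lemma bmulDl x y z : mul (x + y) z = mul x z + mul y z.
Proof. exact: (lin_mapD (fun c u v => bmul_linl c u v z)). Qed.

Lemma bmulBl x y z : mul (x - y) z = mul x z - mul y z.
Proof. exact: (lin_mapB (fun c u v => bmul_linl c u v z)). Qed.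

Lemma bmulZl (c : R[i]) x z : mul (c *: x) z = c *: mul x z.
Proof. exact: (lin_mapZ (fun c u v => bmul_linl c u v z)). Qed.

Lemma bmul0r x : mul x 0 = 0. Proof. exact: (lin_map0 (fun c y z => bmul_linr c y z x)). Qed.

Lemma bmulDr x y z : mul z (x + y) = mul z x + mul z y.
Proof. exact: (lin_mapD (fun c u v => bmul_linr c u v z)). Qed.

Lemma bmulBr x y z : mul z (x - y) = mul z x - mul z y.
Proof. exact: (lin_mapB (fun c u v => bmul_linr c u v z)). Qed.

Lemma bmulZr (c : R[i]) x z : mul z (c *: x) = c *: mul z x.
Proof. exact: (lin_mapZ (fun c u v => bmul_linr c u v z)). Qed.

Lemma rnormM x y : rnorm (mul x y) <= rnorm x * rnorm y.
Proof. by rewrite -lecR rmorphM /= -!rnormE; case: hA. Qed.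

Variable e : A.
Hypothesis mule : forall a, mul a e = a.
Hypothesis mulCl : forall a b c, mul a (mul b c) = mul a (mul c b).
Hypothesis e_neq0 : e != 0.

(** This is [eA], as [e] is idempotent. *)
Definition corner_pred : {pred A} := [pred x | mul e x == x].

Lemma corner_pred_submod : submod_closed corner_pred.
Proof.
split=> [|c x y]; rewrite !inE ?bmul0r // => /eqP ex /eqP ey.
by rewrite bmul_linr ex ey.
Qed.

HB.instance Definition _ :=
  GRing.isSubmodClosed.Build R[i] A corner_pred corner_pred_submod.

Record corner := Corner {cval : A; cvalP : cval \in corner_pred}.

HB.instance Definition _ := [isSub for cval].
HB.instance Definition _ := [Choice of corner by <:].
HB.instance Definition _ := [SubChoice_isSubLmodule of corner by <:].

Lemma cval_inj : injective cval. Proof. exact: val_inj. Qed.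

Lemma e_cval (x : corner) : mul e (cval x) = cval x.
Proof. exact/eqP/(cvalP x). Qed.

Lemma mul_corner x : mul e x \in corner_pred.
Proof. by rewrite inE bmulA mule. Qed.

Definition to_corner x := Corner (mul_corner x).

(** Projecting the product makes membership automatic; [cvalM] shows that the projection changes
    nothing. *)
Definition cmul (x y : corner) := to_corner (mul (cval x) (cval y)).

Lemma cvalM x y : cval (cmul x y) = mul (cval x) (cval y).
Proof. by rewrite /= bmulA e_cval. Qed.

Let cvalD (x y : corner) : cval (x + y) = cval x + cval y. Proof. by []. Qed.

Let cvalZ c (x : corner) : cval (c *: x) = c *: cval x. Proof. by []. Qed.

Fact cmulA : associative cmul.
Proof. by move=> x y z; apply: cval_inj; rewrite !cvalM bmulA. Qed.

Fact cmulC : commutative cmul.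
Proof. by move=> x y; apply: cval_inj; rewrite /= mulCl. Qed.

Fact cmul1 : left_id (to_corner e) cmul.
Proof. by move=> x; apply: cval_inj; rewrite cvalM /= mule e_cval. Qed.

Fact cmulDl : left_distributive cmul +%R.
Proof. by move=> x y z; apply: cval_inj; rewrite cvalD !cvalM cvalD bmulDl. Qed.

Fact corner_one_neq0 : to_corner e != 0.
Proof. by apply: contra_neq e_neq0 => /(congr1 cval) /=; rewrite mule. Qed.

HB.instance Definition _ :=
  GRing.Zmodule_isComNzRing.Build corner cmulA cmulC cmul1 cmulDl corner_one_neq0.

Fact corner_scalerAl (c : R[i]) (x y : corner) : c *: (x * y) = (c *: x) * y.
Proof. by apply: cval_inj; rewrite cvalZ !cvalM cvalZ bmulZl. Qed.

HB.instance Definition _ := GRing.Lmodule_isLalgebra.Build R[i] corner corner_scalerAl.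
HB.instance Definition _ := GRing.Lalgebra_isComAlgebra.Build R[i] corner.

Definition cnorm (x : corner) := rnorm (cval x).

Lemma corner_complete_norm : complete_algebra_norm cnorm.
Proof.
split=> [x y|c x|x h|x y|u r r0 rS ur].
- by rewrite /cnorm cvalD rnormD.
- by rewrite /cnorm cvalZ rnormZ.
- by apply: cval_inj; apply: rnorm0_eq0.
- by rewrite /cnorm cvalM rnormM.
have [l hl] := rnorm_complete (u := cval \o u) r0 rS ur.
exists (to_corner l) => n.
(* The corner is closed, left multiplication by [e] being continuous. *)
suff el : mul e l = l.
  by rewrite /cnorm -[cval _]/(mul e l - cval (u n)) el; exact: hl.
apply/eqP; rewrite -subr_eq0; apply/eqP/rnorm0_eq0/eqP.
have n0 (x : A) : 0 <= rnorm x by rewrite -lecR -rnormE; exact: normr_ge0.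
rewrite eq_le n0 andbT; apply/ler_addgt0Pl => d d0; rewrite addr0.
have k0 : 0 < rnorm e + 1 by rewrite ltr_wpDl.
have [|m rm] := halving_small r0 rS (e := d / (rnorm e + 1)).
  by rewrite divr_gt0.
have -> : mul e l - l = mul e (l - cval (u m)) - (l - cval (u m)).
  by rewrite bmulBr e_cval opprB addrA subrK.
rewrite ltr_pdivlMr // in rm.
have := rnormD (mul e (l - cval (u m))) (- (l - cval (u m))); rewrite rnormN.
have := rnormM e (l - cval (u m)).
have := ler_wpM2l (n0 e) (hl m); have := hl m; rewrite /=; lra.
Qed.

(** With [x = e a], the corner element [x + t = t (1 + x / t)] is invertible as soon as
    [t >= 2 nrm x]. *)
Lemma shifted_invertible a : exists (t : R[i]) z, mul e (mul (a + t *: e) z) = e.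
Proof.
pose x := to_corner a; pose t := 2 * (cnorm x + 1).
have n0 : 0 <= cnorm x := nrm_ge0 corner_complete_norm x.
have t0 : 0 < t by rewrite /t; lra.
have [|w hw] := near_one_inv corner_complete_norm (x := 1 + t^-1%:C *: x).
  rewrite opprD addNKr (nrmN corner_complete_norm) (nrmZr corner_complete_norm).
  by rewrite gtr0_norm ?invr_gt0 // mulrC ler_pdivrMr // /t; lra.
exists t%:C, (cval (t^-1%:C *: w)).
have c1 : cval 1 = e by rewrite /= mule.
rewrite bmulA -[RHS]c1 -hw.
have tK : t%:C * t^-1%:C = 1 :> R[i] by rewrite -rmorphM /= divff // gt_eqF.
have -> : (1 + t^-1%:C *: x) * w = (x + t%:C *: 1) * (t^-1%:C *: w).
  rewrite -scalerAr scalerAl scalerDr scalerA (mulrC t^-1%:C) tK scale1r.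
  by rewrite addrC.
by rewrite [RHS]cvalM cvalD (cvalZ t%:C) c1 /= bmulDr bmulZr mule.
Qed.

Hypothesis radE : jacobson_rad mul = rann mul.

(** If a maximal modular left ideal [L] missed [x], then [L + Ax] would be [A] and [e = l + a x]. So
    [e l] is [1 - (e a) x], invertible in the corner, which puts [e] in [L]. Hence [x] lies in the
    radical, that is in [rann], and [x = e x = 0]. *)
Lemma corner_semisimple (x : corner) :
  (forall y, exists z, (1 - y * x) * z = 1) -> x = 0.
Proof.
move=> hx; suff /(_ e) h : rann mul (cval x).
  by apply: cval_inj; rewrite -e_cval h.
rewrite -radE => L [[[L0 LD LZ LM] _] /eqP LT Lmax].
apply: contrapT => Lx; apply: LT.
pose L' := [set v | exists l a, L l /\ v = l + mul a (cval x)].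
have L'T : L' = setT.
  apply/eqP; apply: contrapT => /negP /Lmax H; apply: Lx.
  rewrite -H; first by exists 0, e; rewrite e_cval add0r.
    split.
    - by exists 0, 0; rewrite bmul0l addr0.
    - move=> _ _ [l [a [Ll ->]]] [m [b [Lm ->]]]; exists (l + m), (a + b).
      by split; [exact: LD | rewrite bmulDl addrACA].
    - move=> c _ [l [a [Ll ->]]]; exists (c *: l), (c *: a).
      by split; [exact: LZ | rewrite bmulZl scalerDr].
    move=> b _ [l [a [Ll ->]]]; exists (mul b l), (mul b a).
    by split; [exact: LM | rewrite bmulDr bmulA].
  by move=> l Ll; exists l, 0; rewrite bmul0l addr0.
have [l [a [Ll el]]] : L' e by rewrite L'T.
have [z] := hx (to_corner a); rewrite mulrC => /(congr1 cval).
rewrite cvalM.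
have c1 : cval 1 = e by rewrite /= mule.
have -> : cval (1 - to_corner a * x) = mul e l.
  have -> : cval (1 - to_corner a * x) = cval 1 - cval (to_corner a * x) by [].
  by rewrite cvalM c1 /= -bmulA -[in X in X - _](mule e) -bmulBr {2}el addrK.
rewrite c1 => Le; apply/seteqP; split=> // v _.
by rewrite -(mule v) -Le; do 3! apply: (LM).
Qed.

(** [x |-> e d(x)] is a derivation of the corner: in [u (e d(v))] the right identity [e] is absorbed
    by [u]. *)
Lemma corner_derivation_eq0 (d : A -> A) (hd : derivation mul d) x :
  mul e x = x -> mul e (d x) = 0.
Proof.
have [dl dM] := hd.
have ede : mul e (d e) = 0.
  have := dM e e; rewrite !mule => /eqP.
  by rewrite -subr_eq0 opprD addNKr oppr_eq0 => /eqP.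
pose D (x : corner) : corner := to_corner (d (cval x)).
move=> ex; suff : D (to_corner x) = 0.
  by move=> /(congr1 cval) /=; rewrite ex.
apply: (semisimple_derivation_eq0 corner_complete_norm corner_semisimple).
  by move=> c u v; apply: cval_inj; rewrite /= dl bmul_linr.
move=> u v; apply: cval_inj.
have -> : cval (D u * v + u * D v) = cval (D u * v) + cval (u * D v) by [].
rewrite !cvalM /=.
have -> : mul e (mul (cval u) (cval v)) = mul (cval u) (cval v).
  by rewrite bmulA e_cval.
by rewrite dM bmulDr !bmulA e_cval mule.
Qed.

End CornerAlgebra.

(** * From commuting maps to inner derivations *)

Section CentralizingInner.
Variables (R : realType) (A : completeNormedModType R[i]) (mul : A -> A -> A).
Variable hA : banach_algebra_mul mul.
Hypothesis radE : jacobson_rad mul = rann mul.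
Hypothesis quoC : quotient_by_rad_commutative mul.
Variable e : A.
Hypothesis mule : forall a, mul a e = a.

Lemma mul_swap a b c : mul a (mul b c) = mul a (mul c b).
Proof.
have := quoC b c; rewrite radE => /(_ a) /eqP.
by rewrite /commutator (bmulBr hA) subr_eq0 => /eqP.
Qed.

Lemma apowS a k : apow mul a k.+2 = mul (apow mul a k.+1) a.
Proof. by []. Qed.

Lemma derivation_sub_rann (d : A -> A) (hd : derivation mul d) x a : mul x (d a) = 0.
Proof.
have [dl dM] := hd.
(* The corner is a nonzero ring only if [e] is nonzero; otherwise [A] is trivial. *)
have [e0|e0] := eqVneq e 0.
  by rewrite -(mule (mul x (d a))) e0 (bmul0r hA).
have d0 c : rann mul c -> rann mul (d c).
  move=> hc b; have := dM b c.
  by rewrite !hc (lin_map0 dl) add0r => /esym.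
have -> : a = mul e a + (a - mul e a) by rewrite addrC subrK.
rewrite (lin_mapD dl) (bmulDr hA) (d0 (a - mul e a)); last first.
  by move=> b; rewrite (bmulBr hA) (bmulA hA) mule subrr.
rewrite addr0 -{1}(mule x) -(bmulA hA).
rewrite (corner_derivation_eq0 hA mule mul_swap e0 radE hd) ?(bmul0r hA) //.
by rewrite (bmulA hA) mule.
Qed.

(** Right multiplication by [a] is injective: [u = u e = u e a z = (u a) z]. *)
Lemma mul_apow_eq0 w a k :
  mul w (apow mul a k.+1) = 0 -> (exists z, mul e (mul a z) = e) -> w = 0.
Proof.
move=> + [z hz]; have cancel u : mul u a = 0 -> u = 0.
  move=> ua; rewrite -(mule u) -hz !(bmulA hA) mule ua.
  by rewrite (bmul0l hA).
elim: k => [|k IHk]; first exact: cancel.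
by rewrite apowS (bmulA hA) => /cancel.
Qed.

Lemma apow_comm a k : mul a (apow mul a k.+1) = mul (apow mul a k.+1) a.
Proof. by elim: k => [//|k IHk]; rewrite apowS (bmulA hA) IHk. Qed.

Lemma commuting_inner (d : A -> A) (hd : derivation mul d) b0 k :
  k_commuting mul k.+1 (fun a => d a + mul b0 a) ->
  forall a, d a = commutator mul a b0.
Proof.
move=> hk; have [dl dM] := hd.
have [e0 a|e0] := eqVneq e 0.
  by rewrite -[LHS]mule -[RHS]mule e0 !(bmul0r hA).
pose G a := d a + mul b0 a - mul a b0.
have Gl c x y : G (c *: x + y) = c *: G x + G y.
  rewrite /G scalerBr scalerDr dl (bmul_linl hA) (bmul_linr hA).
  by rewrite (addrACA (c *: d x)) opprD (addrACA _ _ (- (c *: mul x b0))).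
(* The term [a^k d(a)] vanishes, and [a^k b0 a = a b0 a^k] because factors to the right of the first
   commute. *)
have Gk a : mul (G a) (apow mul a k.+1) = 0.
  have := hk a; rewrite /commutator (bmulDr hA) (derivation_sub_rann hd) add0r.
  rewrite /G (bmulBl hA) => /eqP; rewrite subr_eq0 => /eqP ->.
  apply/eqP; rewrite subr_eq0; apply/eqP.
  rewrite (mul_swap _ b0 a) (bmulA hA) -apow_comm -!(bmulA hA).
  exact: mul_swap.
have Ge : G e = 0.
  by apply: mul_apow_eq0 (Gk e) _; exists e; rewrite !mule.
move=> a.
have [t [z hz]] := shifted_invertible hA mule mul_swap e0 a.
have : G (a + t *: e) = 0 by apply: mul_apow_eq0 (Gk _) _; exists z.
rewrite (lin_mapD Gl) (lin_mapZ Gl) Ge scaler0 addr0 => /eqP.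
by rewrite /G -addrA addr_eq0 opprB => /eqP.
Qed.

End CentralizingInner.

Theorem theorem4p5 (R : realType) (A : completeNormedModType R[i])
  (mul : A -> A -> A) (hA : banach_algebra_mul mul)
  (hrad : jacobson_rad mul = rann mul)
  (hcomm : quotient_by_rad_commutative mul)
  (hright : has_right_identity mul)
  (d : A -> A) (hd : derivation mul d) :
  [<-> inner_derivation mul d;
       exists b0 : A, forall k : nat, (0 < k)%N ->
         k_commuting mul k (fun a => d a + mul b0 a);
       exists (b0 : A) (k : nat), (0 < k)%N /\
         k_commuting mul k (fun a => d a + mul b0 a);
       exists (b0 : A) (k : nat), (0 < k)%N /\
         k_centralizing mul k (fun a => d a + mul b0 a)].
Proof.
have [e mule] := hright.
have swap := mul_swap hA hrad hcomm.
tfae.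
(* Here [d a + b a = a b], and [a b a^k = a a^k b = a^k a b]. *)
- move=> [b hb]; exists b => -[//|k] _ a.
  rewrite hb /commutator subrK -(bmulA hA) swap !(bmulA hA) (apow_comm hA).
  by rewrite subrr.
- by move=> [b hb]; exists b, 1%N; split; last exact: hb.
- move=> [b [k [k0 hk]]]; exists b, k; split=> // a c.
  by rewrite hk (bmul0l hA) (bmul0r hA).
move=> [b [k [k0 hk]]]; case: k k0 hk => // k _ hk; exists b.
apply: (commuting_inner hA hrad hcomm mule hd (k := k)) => a.
(* A central element of the right annihilator is zero. *)
have := hk a e; rewrite mule => ->.
by have := hcomm (d a + mul b a) (apow mul a k.+1); rewrite hrad => /(_ e).
Qed.
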